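(* Let $V$ be a finite dimensional nonzero real vector space and let $T:V\to V$ be a linear operator. Then $T$ has a true-pair vector; that is, there exist real numbers $\alpha,\beta$ and a nonzero vector $v\in V$ such that $$[(T-\alpha I)^2+\beta^2 I](v)=0.$$
   Context: $I$ denotes the identity operator on $V$. A linear operator $T$ on a finite dimensional nonzero real vector space $V$ is said to have a true-pair vector if there exist $\alpha,\beta\in\mathbb{R}$ and a nonzero $v\in V$ with $[(T-\alpha I)^2+\beta^2 I](v)=0$ (the value $\beta=0$ is allowed). *)

(* Defs.v *)
From mathcomp Require Import all_boot all_order all_algebra.
From mathcomp Require Import reals.

Set Implicit Arguments.
Unset Strict Implicit.
Unset Printing Implicit Defensive.

Import GRing.Theory.
Local Open Scope ring_scope.

(* The square is written as a composition because 'End(V) has no canonical ring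
   structure for a general V : vectType R. *)
Definition has_true_pair_vector (R : realType) (V : vectType R) (T : 'End(V)) :
    Prop :=
  exists (alpha beta : R) (v : V), v <> 0 /\
    (((T - alpha *: \1) \o (T - alpha *: \1))%VF + beta ^+ 2 *: \1%VF) v = 0.

(* Main.v *)
Require Import Defs.
From mathcomp Require Import all_boot all_order all_algebra.
From mathcomp Require Import reals complex.

Set Implicit Arguments.
Unset Strict Implicit.
Unset Printing Implicit Defensive.

Import GRing.Theory passmx.
Local Open Scope ring_scope.

(** The complexification of [T] has an eigenvector [x + i y] for some eigenvalue
    [a + i b].  Taking real and imaginary parts gives [T x = a x - b y] and
    [T y = a y + b x], whence [(T - a)^2] acts as [- b^2] on both [x] and [y],
    and at least one of them is nonzero. *)

Lemma Re_sum (R : rcfType) (I : Type) (r : seq I) (P : pred I) (F : I -> R[i]) :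
  Re (\sum_(i <- r | P i) F i) = \sum_(i <- r | P i) Re (F i).
Proof. by apply: (big_morph (@Re R)) => // -[? ?] [? ?]. Qed.

Lemma Im_sum (R : rcfType) (I : Type) (r : seq I) (P : pred I) (F : I -> R[i]) :
  Im (\sum_(i <- r | P i) F i) = \sum_(i <- r | P i) Im (F i).
Proof. by apply: (big_morph (@Im R)) => // -[? ?] [? ?]. Qed.

Lemma real_matrix_eigenpair (R : rcfType) (n : nat) (A : 'M[R]_n) :
    (0 < n)%N ->
  exists (a b : R) (x y : 'rV[R]_n),
    [/\ (x != 0) || (y != 0), x *m A = a *: x - b *: y
      & y *m A = a *: y + b *: x].
Proof.
move=> n_gt0.
(* [Theorem7'] provides an eigenvalue for any square matrix of positive size over [R[i]]; [u] is a
   row eigenvector for [a + i b]. *)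
have [[a b] /eigenvalueP[u uA u_neq0]] :=
  Theorem7' (map_mx (real_complex R) A) n_gt0.
exists a, b, (map_mx (@Re R) u), (map_mx (@Im R) u); split.
- apply: contraNT u_neq0; rewrite negb_or !negbK => /andP[/eqP x0 /eqP y0].
  apply/eqP/rowP => j; apply/eqP; rewrite eq_complex mxE /=.
  by move/rowP/(_ j): x0; move/rowP/(_ j): y0; rewrite !mxE => -> ->; rewrite eqxx.
(* The entries of [A] have zero imaginary part, so taking real or imaginary parts of [u] commutes
   with right multiplication by [A]. *)
- apply/rowP => j; move/rowP/(_ j)/(congr1 (@Re R)): uA.
  rewrite !mxE Re_sum; case: (u ord0 j) => c d /= <-.
  apply: eq_bigr => k _; rewrite !mxE; case: (u ord0 k) => e f /=.
  by rewrite mulr0 subr0.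
- apply/rowP => j; move/rowP/(_ j)/(congr1 (@Im R)): uA.
  rewrite !mxE Im_sum; case: (u ord0 j) => c d /= <-.
  apply: eq_bigr => k _; rewrite !mxE; case: (u ord0 k) => e f /=.
  by rewrite mulr0 add0r.
Qed.

Lemma real_endomorphism_eigenpair (R : rcfType) (V : vectType R) (T : 'End(V)) :
    fullv != 0%VS :> {vspace V} ->
  exists (a b : R) (x y : V),
    [/\ (x != 0) || (y != 0), T x = a *: x - b *: y & T y = a *: y + b *: x].
Proof.
rewrite -dimv_eq0 -lt0n => V_gt0; pose e := vbasis {:V}.
have eB : basis_of {:V} e := vbasisP _.
have [a [b [x [y [xy_neq0 xA yA]]]]] := real_matrix_eigenpair (mxof e e T) V_gt0.
(* Rows are coordinates in the basis [e]: [vecof e] is linear and injective, and turns right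
   multiplication by [mxof e e T] into [T]. *)
exists a, b, (vecof e x), (vecof e y); split; first by rewrite !(vecof_eq0 eB).
- by rewrite (hom_vecof _ eB) xA linearB !linearZ.
- by rewrite (hom_vecof _ eB) yA linearD !linearZ.
Qed.

(** With [S = T - a], the hypotheses read [S x = - b y] and [S y = b x], so
    [S (S x) = - b ^+ 2 x]. *)
Lemma true_pair_eq0 (R : comNzRingType) (V : lmodType R) (T : {linear V -> V})
    (a b : R) (x y : V) :
    T x = a *: x - b *: y -> T y = a *: y + b *: x ->
  T (T x - a *: x) - a *: (T x - a *: x) + b ^+ 2 *: x = 0.
Proof.
move=> Tx Ty; have -> : T x - a *: x = - (b *: y) by rewrite Tx addrC addKr.
rewrite linearN linearZ /= Ty scalerDr !scalerN !scalerA opprK (mulrC b a).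
by rewrite opprD -expr2 addrAC subrK addNr.
Qed.

Theorem theorem1 (R : realType) (V : vectType R) (T : 'End(V))
    (V_neq0 : fullv <> 0%VS :> {vspace V}) :
  has_true_pair_vector T.
Proof.
have true_pairE a b v : ((T - a *: \1) \o (T - a *: \1) + b ^+ 2 *: \1)%VF v =
    T (T v - a *: v) - a *: (T v - a *: v) + b ^+ 2 *: v.
  by rewrite !lfun_simp.
have [a [b [x [y [xy_neq0 Tx Ty]]]]] :=
  real_endomorphism_eigenpair T (introN eqP V_neq0).
case/orP: xy_neq0 => /eqP v_neq0.
  by exists a, b, x; split=> //; rewrite true_pairE (true_pair_eq0 Tx Ty).
(* The pair of relations is invariant under exchanging [x] and [y] while negating [b], which reduces
   this case to the previous one. *)
exists a, (- b), y; split=> //; rewrite true_pairE.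
by apply: (true_pair_eq0 (y := x)); rewrite ?scaleNr ?opprK.
Qed.
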